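(* The ordered indicator $J(a,b)$ defined in the context is quantum endpoint-forcing. That is, for every irreflexive directed graph $H$ and every quantum homomorphism $F:J\to_q H*J$, represented by projections $F_{x,y}$ with $x\in V(J)$ and $y\in V(H*J)$, one has $$F_{a,p}F_{b,q}=0$$ for all pairs $(p,q)$ of vertices of $H*J$ which are not of the form $(u,v)$ with $u\to v$ an arc of $H$ (i.e. which are not the ordered terminal pair of a copy $J_{uv}$).
   Context: All graphs and digraphs are finite and loopless (irreflexive); undirected graphs are simple; directed graphs have no parallel arcs (opposite arcs are allowed). Quantum homomorphism. For finite undirected graphs $X,Y$, a quantum homomorphism $F:X\to_q Y$ is a family of orthogonal projections $\{F_{x,y}: x\in V(X), y\in V(Y)\}$ on a nonzero finite-dimensional Hilbert space with identity $I$ such that: $\sum_{y\in V(Y)}F_{x,y}=I$ for every $x$; $F_{x,y}F_{x,y'}=0$ whenever $y\ne y'$; and $F_{x,y}F_{x',y'}=0$ whenever $xx'\in E(X)$ and $yy'\notin E(Y)$. Gadgets. All private vertices of a gadget are fresh (belonging to that gadget only), and no edges are added other than those listed. - $A$ gadget attached at a vertex $\alpha$ (then $\alpha$ is called an $A$-root): add private vertices $c_0,\dots,c_4$ forming a $5$-cycle $c_0c_1c_2c_3c_4c_0$, and make $\alpha$ adjacent to every $c_i$. - $B$ gadget attached at $\beta$ (then $\beta$ is a $B$-root): add two private vertices $\alpha_1,\alpha_2$, the edges $\beta\alpha_1,\beta\alpha_2,\alpha_1\alpha_2$, and attach a private $A$ gadget at each of $\alpha_1,\alpha_2$. - $E$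 gadget attached at $\epsilon$ (then $\epsilon$ is an $E$-root): add two private vertices $\beta_1,\beta_2$, the edges $\epsilon\beta_1,\epsilon\beta_2,\beta_1\beta_2$, and attach a private $B$ gadget at each of $\beta_1,\beta_2$. Indicator $J=J(a,b)$. Start with a path $x_0-x_1-x_2-x_3-x_4-x_5-x_6$ (the spine), with ordered terminals $a=x_0$, $b=x_6$. Attach an $E$ gadget at each of $x_0,x_6$; an $A$ gadget at each of $x_1,x_2,x_5$; a $B$ gadget at each of $x_3,x_4$. No further edges. Replacement. For an irreflexive directed graph $H$, the undirected graph $H*J$ is obtained by taking, for every arc $u\to v$ of $H$, a fresh copy $J_{uv}$ of $J$ and identifying its terminal $a$ with $u$ and its terminal $b$ with $v$; all nonterminal vertices of the copies are kept distinct; isolated vertices of $H$ remain isolated vertices of $H*J$. *)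

(* Defs.v *)
From mathcomp Require Import all_boot all_order all_algebra.
From mathcomp Require Import sesquilinear complex reals.

Set Implicit Arguments.
Unset Strict Implicit.
Unset Printing Implicit Defensive.

Import GRing.Theory.

Record graph := Graph {
  vertex :> finType;
  adj : rel vertex;
  adj_sym : symmetric adj;
  adj_irr : irreflexive adj }.

Record digraph := Digraph {
  dvertex :> finType;
  arc : rel dvertex;
  arc_irr : irreflexive arc }.

Section QuantumHomomorphism.
Local Open Scope ring_scope.
Variable R : realType.

(* The Hilbert space is C^d with its standard inner product, C = R[i]. *)
Definition orthogonal_projection d (P : 'M[R[i]]_d) : Prop :=
  P *m P = P /\ P \is hermsymmx.

Record quantum_hom (X Y : graph) (d : nat) (F : X -> Y -> 'M[R[i]]_d) : Prop :=
  QuantumHom {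
    qhom_dim : (0 < d)%N;
    qhom_proj : forall x y, orthogonal_projection (F x y);
    qhom_sum : forall x, \sum_y F x y = 1%:M;
    qhom_orth : forall x y y', y != y' -> F x y *m F x y' = 0;
    qhom_adj : forall x x' y y',
      adj x x' -> ~~ adj y y' -> F x y *m F x' y' = 0 }.

End QuantumHomomorphism.

(* [gadget_nbr] is the set of private vertices joined to the root to which the
   gadget gets attached; the root itself is not part of the gadget. *)
Record gadget := Gadget {
  gadget_graph :> graph;
  gadget_nbr : pred gadget_graph }.

Section Attach.
Variables (G : graph) (g : G -> gadget).

(* [inr (Tagged _ w)] with tag v is the private vertex w of the gadget
   attached at v. *)
Definition attach_vertex : finType := (G + {v : G & g v})%type.

Definition attach_adj (s t : attach_vertex) : bool :=
  match s, t with
  | inl u, inl v => adj u v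
  | inl u, inr q => (u == tag q) && gadget_nbr (tagged q)
  | inr p, inl v => (v == tag p) && gadget_nbr (tagged p)
  | inr p, inr q => (tag p == tag q) && adj (tagged p) (tagged_as p q)
  end.

Lemma attach_adj_sym : symmetric attach_adj.
Proof.
case=> [u|p] [v|q] //=; first exact: adj_sym.
case: p q => [u x] [v y] /=; case: (eqVneq u v) => [euv|_] //=.
case: v / euv y => y; pose T v := g v : Type.
rewrite (@tagged_asE _ _ (Tagged T x) y : tagged_as _ _ = y).
rewrite (@tagged_asE _ _ (Tagged T y) x : tagged_as _ _ = x).
exact: adj_sym.
Qed.

Lemma attach_adj_irr : irreflexive attach_adj.
Proof.
case=> [u|[u x]] /=; first exact: adj_irr.
rewrite (@tagged_asE _ _ (Tagged (fun v => g v : Type) x) x : tagged_as _ _ = x).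
by rewrite adj_irr andbF.
Qed.

Definition attach : graph := Graph attach_adj_sym attach_adj_irr.

End Attach.

Definition C5_adj : rel 'I_5 := [rel i j | (j == ordS i) || (i == ordS j)].

Lemma C5_sym : symmetric C5_adj.
Proof. by move=> i j; rewrite /C5_adj /= orbC. Qed.

Lemma C5_irr : irreflexive C5_adj.
Proof. by case; do 5?case=> //. Qed.

Definition C5 : graph := Graph C5_sym C5_irr.

Definition K2_adj : rel bool := [rel s t | s != t].

Lemma K2_sym : symmetric K2_adj.
Proof. by move=> s t; rewrite /K2_adj /= eq_sym. Qed.

Lemma K2_irr : irreflexive K2_adj.
Proof. by move=> s; rewrite /K2_adj /= eqxx. Qed.

Definition K2 : graph := Graph K2_sym K2_irr.

Definition spine_adj : rel 'I_7 :=
  [rel i j | (val j == (val i).+1) || (val i == (val j).+1)].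

Lemma spine_sym : symmetric spine_adj.
Proof. by move=> i j; rewrite /spine_adj /= orbC. Qed.

Lemma spine_irr : irreflexive spine_adj.
Proof. by move=> i; rewrite /spine_adj /= ltn_eqF. Qed.

Definition spine : graph := Graph spine_sym spine_irr.

Definition A_gadget : gadget := @Gadget C5 predT.

(* The root is joined to two new adjacent vertices, each carrying a copy of the
   gadget g. *)
Definition pair_gadget (g : gadget) : gadget :=
  @Gadget (attach (fun _ : K2 => g))
    (fun w => if w is inl _ then true else false).

Definition B_gadget : gadget := pair_gadget A_gadget.
Definition E_gadget : gadget := pair_gadget B_gadget.

Record indicator := Indicator {
  ind_graph :> graph;
  term_a : ind_graph;
  term_b : ind_graph;
  term_neq : term_a != term_b }.

Definition J_gadget (i : spine) : gadget :=
  nth A_gadget [:: E_gadget; A_gadget; A_gadget; B_gadget; B_gadget;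
                   A_gadget; E_gadget] (val i).

Definition J_graph : graph := attach J_gadget.

Definition J_term_a : J_graph := inl (@ord0 6).
Definition J_term_b : J_graph := inl (@ord_max 6).

Lemma J_term_neq : J_term_a != J_term_b.
Proof. by []. Qed.

Definition J : indicator := Indicator J_term_neq.

Section Replacement.
Variables (H : digraph) (I : indicator).

Definition arc_type : finType := {e : H * H | arc e.1 e.2}.
Definition nonterminal : finType :=
  {x : I | (x != term_a I) && (x != term_b I)}.

Definition repl_vertex : finType := (H + arc_type * nonterminal)%type.

(* The vertex of H * I which is the image of the vertex x of the copy I_e. *)
Definition copy_vertex (e : arc_type) (x : I) : repl_vertex :=
  match insub x : option nonterminal with
  | Some x' => inr (e, x')
  | None => inl (if x == term_a I then (val e).1 else (val e).2)
  end.

Definition repl_adj (s t : repl_vertex) : bool :=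
  [exists e : arc_type, exists x : I, exists y : I,
    [&& adj x y, s == copy_vertex e x & t == copy_vertex e y]].

Lemma repl_adj_sym : symmetric repl_adj.
Proof.
suff imp s t : repl_adj s t -> repl_adj t s.
  by move=> s t; apply/idP/idP; apply: imp.
move=> /existsP[e /existsP[x /existsP[y /and3P[xy sx ty]]]].
apply/existsP; exists e; apply/existsP; exists y; apply/existsP; exists x.
by rewrite adj_sym xy sx ty.
Qed.

Lemma copy_vertex_inj e : injective (copy_vertex e).
Proof.
have ne : (val e).1 != (val e).2.
  by apply: contraTneq (valP e) => /= ->; rewrite arc_irr.
move=> x y; rewrite /copy_vertex.
case: insubP => [x' _ <-|nx]; case: insubP => [y' _ <-|ny] //; first by case=> ->.
move: nx ny; rewrite !negb_and !negbK.
case: (eqVneq x (term_a I)) => [->|_] /=;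
  case: (eqVneq y (term_a I)) => [->|_] //=.
- by move=> _ _ [e12]; rewrite e12 eqxx in ne.
- by move=> _ _ [e12]; rewrite e12 eqxx in ne.
- by move=> /eqP-> /eqP->.
Qed.

Lemma repl_adj_irr : irreflexive repl_adj.
Proof.
move=> s; apply/negbTE/negP => /existsP[e /existsP[x /existsP[y]]].
case/and3P=> xy /eqP-> /eqP.
by move/copy_vertex_inj => exy; rewrite exy adj_irr in xy.
Qed.

Definition replacement : graph := Graph repl_adj_sym repl_adj_irr.

Definition repl_inl (u : H) : replacement := inl u.

End Replacement.

Definition quantum_endpoint_forcing (R : realType) (I : indicator) : Prop :=
  forall (H : digraph) (d : nat) (F : I -> replacement H I -> 'M[R[i]]_d),
    quantum_hom F ->
    forall p q : replacement H I,
      ~ (exists u v : H, [/\ arc u v, p = repl_inl I u & q = repl_inl I v]) ->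
      (F (term_a I) p *m F (term_b I) q = 0)%R.

(* Main.v *)
Require Import Defs.
From mathcomp Require Import all_boot all_order all_algebra.
From mathcomp Require Import complex reals.
From mathcomp Require Import sesquilinear spectral zify.

(** The spine of J can only be mapped, even by a quantum homomorphism, onto the
spine of a copy of J, because every vertex carrying a gadget remembers which
gadget it carries.

Give every vertex of H * J a level: 0 on the 5-cycles, 1 on the A-roots, 2 on
the B-roots, 3 on the E-roots, hence 3 on the vertices of H.  The gadgets form a
tower, A, B, E being iterates of one construction, and the level is one more
than the height of the gadget carried.  The shape of H * J enters only through
its triangles: each consists of two vertices of some level n and a third one of
level n + 1 ([attach_leveled], [repl_leveled]), since the only triangles are
those formed by a gadget root and an edge of its gadget.  If n is positive the
base of the triangle is the pair of roots of a pair gadget, which a boolean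
tells apart.

Levels are forced ([qhom_level]).  Suppose that F x y is nonzero.
- If x carries an A gadget, the neighbourhood of y is not bipartite
  ([qhom_odd_wheel]).  From the shape of the triangles, the neighbourhood of
  any vertex whose level is not 1 is bipartite, so y has level 1.
- If x carries the gadget of height n + 1, it lies in a triangle x, x1, x2
  where x1 and x2 carry the gadget of height n.  There is a triangle y, z1, z2
  with F x1 z1 and F x2 z2 nonzero ([qhom_triangle]).  By induction z1 and z2
  have the same level n + 1, so they are the base of this triangle and y has
  level n + 2.

The non-bipartiteness is where the Hilbert space matters.  For a bipartition of
the neighbours of y let Q k true and Q k false be the sums of the F (c k) z over
the two classes, for consecutive vertices c k of the odd cycle.  On the range of
F x y the two add up to the identity, while Q k b and Q (k + 1) b are
orthogonal.  A vector v of that range thus has Q k b v equal to the projection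
of Q (k + 1) (~~ b) v and conversely; a projection that does not decrease the
norm fixes the vector, so the two are equal ([mulmx_proj_eq]).  Around an odd
cycle this yields Q 0 true v = Q 0 false v, and these vectors are orthogonal, so
both vanish and v = 0.

Finally, if F a p F b q is nonzero, inserting the identity at each inner vertex
of the spine produces a walk from p to q in H * J along which F does not vanish
([qhom_walk]).  Its levels are 3, 1, 1, 2, 2, 1, 3.  A walk with these levels
has to run along the spine of a single copy, forwards ([spine_walk_arc]): from
the other end of the spine the second step would fail, the vertex x5 having no
neighbour of level 1. *)

Set Implicit Arguments.
Unset Strict Implicit.
Unset Printing Implicit Defensive.

Import GRing.Theory Num.Theory.

(** * Projections *)

Section Projections.
Local Open Scope ring_scope.
Local Open Scope sesquilinear_scope.
Variable R : realType.
Local Notation C := R[i].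

Lemma mulmx_adjoint_eq0 m n (D : 'M[C]_(m, n)) : D *m D^t* = 0 -> D = 0.
Proof.
move=> D0; apply/matrixP=> i j; rewrite mxE.
have /eqP := congr1 (fun M : 'M_m => M i i) D0; rewrite !mxE.
under eq_bigr => k _ do rewrite !mxE -normCK.
rewrite psumr_eq0 => [|k _]; last by rewrite exprn_ge0.
by move/allP/(_ j (mem_index_enum _)); rewrite sqrf_eq0 normr_eq0 => /eqP.
Qed.

Lemma orthogonal_projectionP d (P : 'M[C]_d) :
  orthogonal_projection P <-> P *m P = P /\ P^t* = P.
Proof.
rewrite /orthogonal_projection; split=> -[PP hP]; split=> //.
  by move/is_hermitianmxP: hP; rewrite expr0 scale1r => {2}->.
by apply/is_hermitianmxP; rewrite expr0 scale1r.
Qed.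

(** In terms of the adjoint vectors: v P is the projection of v Q and v Q that
of v P, so neither projection shortens its vector.  Computationally, the
hypotheses make the squared norm of v P - v Q vanish. *)
Lemma mulmx_proj_eq d m (V : 'M[C]_(m, d)) (P Q : 'M[C]_d) :
    orthogonal_projection P -> orthogonal_projection Q ->
    V *m P = V *m Q *m P -> V *m Q = V *m P *m Q ->
  V *m P = V *m Q.
Proof.
move=> /orthogonal_projectionP[PP hP] /orthogonal_projectionP[QQ hQ] eP eQ.
apply/subr0_eq/mulmx_adjoint_eq0; rewrite -mulmxBr trmx_mul map_mxM mulmxA.
suff -> : V *m (P - Q) *m (P - Q)^t* = 0 by rewrite mul0mx.
have -> : (P - Q)^t* = P - Q by rewrite linearB /= map_mxB hP hQ.
rewrite !mulmxBr !mulmxBl.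
by rewrite -!mulmxA PP QQ !mulmxA -eP -eQ subrr sub0r opprB subrr.
Qed.

Lemma orthogonal_projection_sum d (I : finType) (S : pred I)
    (P : I -> 'M[C]_d) :
    (forall i, orthogonal_projection (P i)) ->
    (forall i j, i != j -> P i *m P j = 0) ->
  orthogonal_projection (\sum_(i | S i) P i).
Proof.
move=> projP orthP; apply/orthogonal_projectionP; split; last first.
  rewrite raddf_sum raddf_sum; apply: eq_bigr => i _.
  by have /orthogonal_projectionP[] := projP i.
rewrite mulmx_suml; apply: eq_bigr => i Si.
rewrite mulmx_sumr (bigD1 i) //= big1 => [|j /andP[_ ji]].
  by rewrite addr0; have /orthogonal_projectionP[] := projP i.
by rewrite orthP // eq_sym.
Qed.

End Projections.

(** * Transport of walks, triangles and odd wheels *)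

Section QuantumHom.
Local Open Scope ring_scope.
Variables (R : realType) (X Y : graph) (d : nat) (F : X -> Y -> 'M[R[i]]_d).
Hypothesis qF : quantum_hom F.

Lemma qhom_neq0 x x' y y' :
  adj x x' -> F x y *m F x' y' != 0 ->
  [/\ adj y y', F x y != 0 & F x' y' != 0].
Proof.
move=> xx' nz; split.
- by apply: contra_neqT nz => /(qhom_adj qF xx').
- by apply: contra_neq nz => ->; rewrite mul0mx.
- by apply: contra_neq nz => ->; rewrite mulmx0.
Qed.

Lemma qhom_expand m n (M : 'M_(m, d)) x (N : 'M_(d, n)) :
  M *m N = \sum_y M *m F x y *m N.
Proof. by rewrite -mulmx_suml -mulmx_sumr (qhom_sum qF) mulmx1. Qed.

(** The identity, written as the sum of the F x y, is inserted between the two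
factors; some term is nonzero, and then so is each half of it. *)
Lemma qhom_step m n (M : 'M_(m, d)) x (N : 'M_(d, n)) :
  M *m N != 0 -> exists y, M *m F x y != 0 /\ F x y *m N != 0.
Proof.
move=> nz; have /existsP[y My] : [exists y, M *m F x y *m N != 0].
  apply: contra_neqT nz; rewrite negb_exists => /forallP y0.
  by rewrite (qhom_expand _ x) big1 // => y _; apply/eqP/negbNE/y0.
exists y; split; apply: contra_neq My; last by rewrite -mulmxA => ->; rewrite mulmx0.
by move->; rewrite mul0mx.
Qed.

(** The identity is inserted at each inner vertex of the walk in turn.  The
projections do not commute, so no single map of the vertices arises: the lifted
walk t depends on its ends p and q. *)
Lemma qhom_walk x s p q :
  path (@adj X) x s -> F x p *m F (last x s) q != 0 ->
  exists t, [/\ path (@adj Y) p t, last p t = q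
    & all2 (fun u v => F u v != 0) (x :: s) (p :: t)].
Proof.
elim: s x p => [|x' s IH] x p /=.
  move=> _ nz; exists [::] => /=; case: (eqVneq p q) nz => [<-|pq].
    have [-> _] := qhom_proj qF x p => ->; split=> //.
  by rewrite (qhom_orth qF) // eqxx.
case/andP=> xx' xs /(qhom_step x')[p' [nz /(IH _ _ xs)[t [pt lt al]]]].
have [pp' p0 _] := qhom_neq0 xx' nz.
by exists (p' :: t); rewrite /= pp' p0.
Qed.

(** The range of F x y is contained in the space spanned by the ranges of the
F x' z with z a neighbour of y; this local form of the identity is what lets a
neighbourhood of x constrain the neighbourhood of y. *)
Lemma qhom_nbr x x' y :
  adj x x' -> F x y = F x y *m \sum_(z | adj y z) F x' z.
Proof.
move=> xx'; rewrite -{1}[F x y]mulmx1 -(qhom_sum qF x') !mulmx_sumr.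
rewrite [LHS](bigID (adj y)) /= [X in _ + X]big1 ?addr0 // => z.
exact: (qhom_adj qF).
Qed.

(** If the neighbours of y where F x1 and F x2 live were nowhere adjacent, the
two local identities at x1 and x2 would have product zero. *)
Lemma qhom_triangle x x1 x2 y :
    adj x x1 -> adj x x2 -> adj x1 x2 -> F x y != 0 ->
  exists z1 z2, [/\ adj y z1, adj y z2, adj z1 z2, F x1 z1 != 0 & F x2 z2 != 0].
Proof.
move=> xx1 xx2 x12 nz.
have /existsP[z1 /existsP[z2 /and3P[yz1 yz2 z12]]] : [exists z1, exists z2,
  [&& adj y z1, adj y z2 & F x1 z1 *m F x2 z2 != 0]].
  apply: contra_neqT nz; rewrite negb_exists => /forallP z0.
  rewrite (qhom_nbr y xx2) {1}(qhom_nbr y xx1) -mulmxA.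
  rewrite mulmx_suml big1 ?mulmx0 // => z1 yz1; rewrite mulmx_sumr big1 // => z2 yz2.
  have := z0 z1; rewrite negb_exists => /forallP/(_ z2).
  by rewrite yz1 yz2 /= negbK => /eqP.
by have [? ? ?] := qhom_neq0 x12 z12; exists z1, z2.
Qed.

(** An odd wheel is not mapped into a cone over a bipartite graph: f is a
tentative bipartition of the neighbourhood of y, and some edge of that
neighbourhood must violate it.  The odd closed walk is indexed by the natural
numbers so that the argument is an induction along it. *)
Lemma qhom_odd_wheel n (c : nat -> X) x y (f : Y -> bool) :
    odd n -> c n = c 0%N -> (forall k, adj (c k) (c k.+1)) ->
    (forall k, adj x (c k)) -> F x y != 0 ->
  exists z z', [/\ adj y z, adj y z', adj z z' & f z = f z'].
Proof.
move=> on cn0 cc xc nz.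
case: (boolP [exists z, exists z', [&& adj y z, adj y z', adj z z' & f z == f z']]).
  by case/existsP=> z /existsP[z' /and4P[? ? ? /eqP]]; exists z, z'.
rewrite negb_exists => /forallP bip; case/eqP: nz.
have {}bip z z' : adj y z -> adj y z' -> f z = f z' -> ~~ adj z z'.
  have := bip z; rewrite negb_exists => /forallP/(_ z').
  by case: (adj y z); case: (adj y z'); case: (adj z z') => //= /negP + _ _ /eqP.
(* The two local identities at c k and c k.+1 each split in two classes, equal
   classes being orthogonal: this matches Q k b with Q k.+1 (~~ b). *)
pose Q k b := \sum_(z | adj y z && (f z == b)) F (c k) z.
have Qproj k b : orthogonal_projection (Q k b).
  apply: orthogonal_projection_sum => [z|z z']; first exact: (qhom_proj qF).
  exact: (qhom_orth qF).
have FQ k b : F x y = F x y *m Q k b + F x y *m Q k (~~ b).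
  rewrite -mulmxDr {1}(qhom_nbr y (xc k)) (bigID (fun z => f z == b)) /=.
  congr (_ *m (_ + _)); apply: eq_bigl => z; congr (_ && _).
  by case: (f z) b => -[].
have QQ0 k b : Q k b *m Q k.+1 b = 0 /\ Q k.+1 b *m Q k b = 0.
  have bad z z' : adj y z && (f z == b) -> adj y z' && (f z' == b) -> ~~ adj z z'.
    by case/andP=> yz /eqP fz /andP[yz' /eqP fz']; apply: bip; rewrite // fz.
  have cc' : adj (c k.+1) (c k) by rewrite adj_sym.
  split; rewrite mulmx_suml big1 // => z zb; rewrite mulmx_sumr big1 // => z' zb'.
    exact: qhom_adj qF _ _ _ _ (cc k) (bad _ _ zb zb').
  exact: qhom_adj qF _ _ _ _ cc' (bad _ _ zb zb').
have Qstep k b : F x y *m Q k b = F x y *m Q k.+1 (~~ b).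
  apply: mulmx_proj_eq; try exact: Qproj.
    by rewrite {1}(FQ k.+1 b) mulmxDl -mulmxA (proj2 (QQ0 k b)) mulmx0 add0r.
  rewrite {1}(FQ k b) mulmxDl -[_ *m Q k (~~ b) *m _]mulmxA.
  by rewrite (proj1 (QQ0 k (~~ b))) mulmx0 addr0.
have Qrot k b : F x y *m Q 0 b = F x y *m Q k (odd k (+) b).
  by elim: k => [|k ->]; rewrite ?addFb //= Qstep -addNb.
have Q0 b : F x y *m Q 0 b = 0.
  have [QQ _] := Qproj 0 b; rewrite -QQ mulmxA (Qrot n) on /Q cn0 -mulmxA.
  rewrite mulmx_suml big1 ?mulmx0 // => z /andP[_ /eqP fz].
  rewrite mulmx_sumr big1 // => z' /andP[_ /eqP fz']; apply: (qhom_orth qF).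
  by apply: contra_eq_neq fz => ->; rewrite fz' addTb; case: (b).
by rewrite (FQ 0 true) !Q0 addr0.
Qed.

End QuantumHom.

(** * Levels and triangles *)

(** The level of a vertex, and a boolean whose only purpose is to tell apart
the two roots of a pair gadget. *)
Definition label := (nat * bool)%type.

(** The labels of a triangle made of a gadget root, p, and an edge of the
gadget.  Level 0 is exempt from the condition on booleans because a 5-cycle has
no proper 2-colouring: this is what distinguishes an A gadget. *)
Definition peak (p q r : label) : bool :=
  [&& q.1 == r.1, p.1 == q.1.+1 & (0 < q.1) ==> (q.2 != r.2)].

Definition peaked (p q r : label) : bool :=
  [|| peak p q r, peak q p r | peak r p q].

Lemma peakC p q r : peak p q r = peak p r q.
Proof.
by rewrite /peak eq_sym (eq_sym q.2); case: eqVneq => //= ->.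
Qed.

Lemma peakedC p q r : peaked p q r = peaked q p r.
Proof. by rewrite /peaked orbCA (peakC r). Qed.

Lemma peakedCA p q r : peaked p q r = peaked p r q.
Proof. by rewrite /peaked (peakC p) orbA orbAC orbA. Qed.

Definition leveled (X : graph) (l : X -> label) : Prop :=
  forall x y z, adj x y -> adj x z -> adj y z -> peaked (l x) (l y) (l z).

(** Conditions under which attaching the gadget to a vertex of level n + 1
creates only peaked triangles.  The bound on all levels confines the vertices of
level 3 of the final graph to those of H. *)
Definition graded (n : nat) (g : gadget) (l : g -> label) : Prop :=
  [/\ leveled l,
      forall w, (l w).1 <= n,
      forall w, gadget_nbr w -> (l w).1 = n
    & forall w w', gadget_nbr w -> gadget_nbr w' -> adj w w' -> 0 < n ->
        (l w).2 != (l w').2].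

Definition triangle_free (G : graph) : Prop :=
  forall u v w : G, adj u v -> adj u w -> ~~ adj v w.

Section AttachTheory.
Variables (G : graph) (g : G -> gadget).

Lemma attach_adj_inr (p q : {v : G & g v}) :
  @adj (attach g) (inr p) (inr q) ->
  exists2 w : g (tag p), q = Tagged (fun v => g v : Type) w & adj (tagged p) w.
Proof.
case: p q => [u x] [v y] /= /andP[/eqP euv].
by case: v / euv y => y; rewrite tagged_asE; exists y.
Qed.

Lemma attach_adj_same v (w w' : g v) :
  @adj (attach g) (inr (Tagged (fun v => g v : Type) w))
    (inr (Tagged (fun v => g v : Type) w')) = adj w w'.
Proof. by rewrite /= eqxx tagged_asE. Qed.

Variables (h : G -> nat) (b : G -> bool) (l : forall v, g v -> label).
Arguments l {v}.

Definition attach_label (s : attach g) : label :=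
  match s with inl v => ((h v).+1, b v) | inr p => l (tagged p) end.

(** A triangle-free graph contributes no triangle, and two of its vertices have
no common private neighbour; so a triangle has one root and an edge of its
gadget, or lies inside a gadget. *)
Lemma attach_leveled :
  triangle_free G -> (forall v, graded (h v) (@l v)) -> leveled attach_label.
Proof.
move=> tfG gr.
have root v (w w' : g v) : gadget_nbr w -> gadget_nbr w' -> adj w w' ->
    peaked ((h v).+1, b v) (l w) (l w').
  have [_ _ top sep] := gr v => nw nw' ww'.
  rewrite /peaked /peak (top _ nw) (top _ nw') /= !eqxx.
  by case: posnP => //= hv; rewrite (sep _ _ nw nw' ww').
(* Being peaked is symmetric in the three labels, so a triangle with a private
   vertex may be assumed to have one in third position. *)
suff main x y (w : {v : G & g v}) :
    adj (x : attach g) y -> @adj (attach g) x (inr w) ->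
    @adj (attach g) y (inr w) ->
    peaked (attach_label x) (attach_label y) (attach_label (inr w)).
  case=> [u|p] [v|q] [w|r] xy xz yz; try exact: main.
  - by have := tfG _ _ _ xy xz; rewrite [adj v w]yz.
  - by rewrite peakedCA; apply: main; rewrite // adj_sym.
  - by rewrite peakedC peakedCA; apply: main; rewrite // adj_sym.
  - by rewrite peakedCA; apply: main; rewrite // adj_sym.
case: x y w => [u|p] [v|q] r.
- move=> uv /andP[/eqP eu _] /andP[/eqP ev _].
  by move: uv; rewrite eu ev adj_irr.
- move=> /andP[/eqP -> nq] /andP[_ nr] /attach_adj_inr[w er qw].
  by subst r; apply: root.
- move=> /andP[/eqP -> np] /attach_adj_inr[w er pw] /andP[_ nr].
  by subst r; rewrite peakedC; apply: root.
- move=> /attach_adj_inr[w -> pw] /attach_adj_inr[w' -> pw'].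
  rewrite attach_adj_same => ww' /=.
  by have [lev _ _ _] := gr (tag p); apply: lev.
Qed.

Lemma attach_nbr_root v y : (forall v, graded (h v) (@l v)) ->
  @adj (attach g) (inl v) y -> (attach_label y).1 != h v ->
  exists2 u, y = inl u & adj v u.
Proof.
move=> gr; case: y => [u|q] //=; first by exists u.
by case/andP=> /eqP -> nq; have [_ _ /(_ _ nq)-> _] := gr (tag q); rewrite eqxx.
Qed.

Lemma attach_nbr_private (p : {v : G & g v}) y : (forall v, graded (h v) (@l v)) ->
  @adj (attach g) (inr p) y -> (attach_label y).1 <= (h (tag p)).+1.
Proof.
move=> gr; case: y => [u /andP[/eqP -> _] //|q /attach_adj_inr[w -> _] /=].
by have [_ le _ _] := gr (tag p); apply: leqW.
Qed.

End AttachTheory.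

(** * Towers of gadgets *)

(** The A, B and E gadgets are the towers of heights 0, 1 and 2. *)
Definition tower (n : nat) : gadget := iter n pair_gadget A_gadget.

Lemma C5_triangle_free : triangle_free C5.
Proof. by do 3!case=> [[|[|[|[|[|//]]]]] ?]. Qed.

Lemma K2_triangle_free : triangle_free K2.
Proof. by case; case; case. Qed.

Lemma spine_triangle_free : triangle_free spine.
Proof.
by move=> u v w /orP[]/eqP uv /orP[]/eqP uw; apply/norP; split; apply/eqP; lia.
Qed.

Lemma tower_graded n : {l : tower n -> label | graded n l}.
Proof.
elim: n => [|n [l gr]].
  exists (fun=> (0, false)); split=> // u v w uv uw vw.
  by have := C5_triangle_free uv uw; rewrite vw.
exists (attach_label (fun _ : K2 => n) id (fun=> l)); split.
- exact: (@attach_leveled K2 (fun=> tower n) (fun=> n) id (fun=> l)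
    K2_triangle_free (fun=> gr)).
- case=> [u|p] /=; first exact: leqnn.
  by have [_ le _ _] := gr; apply: leqW.
- by case.
- by case=> [u|p] [v|q].
Qed.

(** Quantum homomorphisms see only the edges of their source, so a homomorphic
image of a gadget can stand for a copy of it. *)
Definition attached (g : gadget) (X : graph) (x : X) : Prop :=
  exists2 phi : g -> X, {homo phi : w w' / adj w w'}
    & forall w, gadget_nbr w -> adj x (phi w).

Lemma attached_private (G : graph) (g : G -> gadget) (v : G) :
  attached (g v) (inl v : attach g).
Proof.
exists (fun w => inr (Tagged (fun v => g v : Type) w)) => [w w'|w nw].
  by rewrite attach_adj_same.
by rewrite /= eqxx.
Qed.

Lemma attached_homo g (X X' : graph) (phi : X -> X') x :
  {homo phi : w w' / adj w w'} -> attached g x -> attached g (phi x).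
Proof.
move=> hphi [psi hpsi xpsi]; exists (phi \o psi) => [w w' /hpsi/hphi //|w nw].
exact/hphi/xpsi.
Qed.

(** The odd wheel of an A gadget can only be centred at level 1, and each
further storey of the tower is a triangle, which raises the level by one. *)
Lemma qhom_level (R : realType) (X Y : graph) d (F : X -> Y -> 'M[R[i]]_d)
    (l : Y -> label) n x y :
    quantum_hom F -> leveled l -> attached (tower n) x -> F x y != 0%R ->
  (l y).1 = n.+1.
Proof.
move=> qF lev; elim: n x y => [|n IH] x y [phi hphi xphi] nz.
  pose c k := phi (inZp k).
  (* Among the neighbours of y, the edges below y are bases of triangles with
     apex y, separated by the boolean unless they have level 0; every other edge
     joins a vertex of the level of y to one of the next level. *)
  pose f z := if (l z).1 < (l y).1 then (l z).2 else (l z).1 == (l y).1.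
  have c5 : c 5 = c 0 by congr phi; apply: val_inj.
  have cc k : adj (c k) (c k.+1).
    apply/hphi/orP; left; rewrite -val_eqE /=.
    by rewrite -[k.+1]addn1 -modnDml addn1.
  have [z [z' [yz yz' zz' fzz']]] :=
    qhom_odd_wheel (n := 5) qF f isT c5 cc (fun k => xphi (inZp k) isT) nz.
  have := lev _ _ _ yz yz' zz'; move: fzz'; rewrite /f /peaked /peak.
  case: (l y) (l z) (l z') => [i p] [j q] [k r] /=.
  by case: (ltnP j i); case: (ltnP k i); case: q r => -[] /=; lia.
have [z1 [z2 [yz1 yz2 z12 nz1 nz2]]] :=
  qhom_triangle qF (xphi (inl true) isT) (xphi (inl false) isT)
    (hphi (inl true) (inl false) isT) nz.
have att b : attached (tower n) (phi (inl b)).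
  by apply: (attached_homo hphi); apply: (@attached_private K2 (fun=> tower n)).
have e1 := IH _ _ (att true) nz1; have e2 := IH _ _ (att false) nz2.
have := lev _ _ _ yz1 yz2 z12.
by rewrite /peaked /peak e1 e2; lia.
Qed.

(** * Triangles in a replacement graph *)

Section ReplacementTheory.
Variables (H : digraph) (I : indicator).
Hypothesis nab : ~~ adj (term_a I) (term_b I).
Local Notation Y := (replacement H I).
Local Notation arcs := (arc_type H).
Local Notation copy e x := (copy_vertex e x : Y).

Definition terminal (x : I) := (x == term_a I) || (x == term_b I).

Variant copy_spec (e : arcs) (x : I) : Y -> bool -> Type :=
| CopyTerminalA of x = term_a I : copy_spec e x (inl (val e).1) true
| CopyTerminalB of x = term_b I : copy_spec e x (inl (val e).2) true
| CopyNonterminal x' of x = val x' : copy_spec e x (inr (e, x')) false.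

Lemma copyP e x : copy_spec e x (copy e x) (terminal x).
Proof.
rewrite /copy_vertex /terminal; case: insubP => [x' nt xE|].
  by rewrite -[_ || _]negbK negb_or nt; constructor.
rewrite -negb_or negbK; case: eqVneq => [xa _|_ /= xb].
  by constructor.
by rewrite xb; constructor; apply/eqP.
Qed.

Lemma terminal_adj x y : terminal x -> terminal y -> ~~ adj x y.
Proof.
by do 2![case/orP=> /eqP->]; rewrite ?adj_irr // adj_sym.
Qed.

Lemma copy_eq_nonterminal e e' x x' :
  ~~ terminal x -> copy e x = copy e' x' -> e = e' /\ x = x'.
Proof.
case: copyP => // w -> _; case: copyP => // w' -> [-> ->] //.
Qed.

Lemma repl_adjP (s t : Y) :
  adj s t -> exists e x y, [/\ adj x y, s = copy e x & t = copy e y].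
Proof.
by case/existsP=> e /existsP[x /existsP[y /and3P[xy /eqP-> /eqP->]]]; exists e, x, y.
Qed.

Lemma repl_nbr e x (t : Y) :
  ~~ terminal x -> adj (copy e x) t -> exists2 y, t = copy e y & adj x y.
Proof.
move=> nx /repl_adjP[e' [x' [y [xy /(copy_eq_nonterminal nx)[-> ->] ->]]]].
by exists y.
Qed.

Lemma copy_adj e x y : adj (copy e x) (copy e y) -> adj x y.
Proof.
have nt u v : ~~ terminal u -> adj (copy e u) (copy e v) -> adj u v.
  by move=> nu /(repl_nbr nu)[w /copy_vertex_inj->].
have [tx|nx] := boolP (terminal x); last exact: nt.
have [ty|ny] := boolP (terminal y); last first.
  by rewrite adj_sym => yx; rewrite adj_sym; apply: nt yx.
case/repl_adjP=> e' [x' [y' [xy']]].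
case: copyP tx => // _ _; case: copyP ty => // _ _.
all: by case: copyP (@terminal_adj x' y') => //; case: copyP => // ? ? /(_ isT isT)/negP.
Qed.

(** Copies meet only in terminals, and terminals are not adjacent, so one of the
vertices of any edge is nonterminal and determines the copy. *)
Lemma repl_triangle (s t r : Y) : adj s t -> adj s r -> adj t r ->
  exists e x y z, [/\ s = copy e x, t = copy e y, r = copy e z
    & [/\ adj x y, adj x z & adj y z]].
Proof.
suff main (s' t' : Y) e x y : s' = copy e x -> t' = copy e y -> ~~ terminal x ->
    adj s' t' -> adj s' r -> adj t' r ->
  exists e x y z, [/\ s' = copy e x, t' = copy e y, r = copy e z
    & [/\ adj x y, adj x z & adj y z]].
  move=> st sr tr; have [e [x [y [xy es et]]]] := repl_adjP st.
  have [tx|nx] := boolP (terminal x); last exact: main es et nx st sr tr.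
  have ny : ~~ terminal y by apply: contraTN xy => ty; apply: terminal_adj.
  have ts : adj t s by rewrite adj_sym.
  have [e' [y' [x' [z [-> -> -> [yx yz xz]]]]]] := main _ _ _ _ _ et es ny ts tr sr.
  by exists e', x', y', z; rewrite adj_sym.
move=> -> -> nx /copy_adj xy /(repl_nbr nx)[z -> xz] /copy_adj yz.
by exists e, x, y, z.
Qed.

Variable l : I -> label.

Definition repl_label (s : Y) : label :=
  match s with inl _ => l (term_a I) | inr (_, x) => l (val x) end.

Hypothesis lab : l (term_a I) = l (term_b I).

Lemma repl_label_copy e x : repl_label (copy e x) = l x.
Proof. by case: copyP => [->|->|x' ->]. Qed.

Lemma repl_leveled : leveled l -> leveled repl_label.
Proof.
move=> lev s t r st sr tr.
have [e [x [y [z [-> -> -> [xy xz yz]]]]]] := repl_triangle st sr tr.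
by rewrite !repl_label_copy; apply: lev.
Qed.

End ReplacementTheory.

(** * The indicator J *)

Definition height (k : nat) : nat := nth 0 [:: 2; 0; 0; 1; 1; 0; 2] k.

Lemma J_gadgetE (i : spine) : J_gadget i = tower (height (val i)).
Proof. by case: i => [[|[|[|[|[|[|[|//]]]]]]] ?]. Qed.

(** A labelling of each gadget, transported from its tower along [J_gadgetE];
packing it with its property keeps the casts out of sight. *)
Lemma J_grading (i : spine) : {l : J_gadget i -> label | graded (height (val i)) l}.
Proof. by rewrite J_gadgetE; apply: tower_graded. Qed.

Definition J_label : J -> label :=
  attach_label (fun i : spine => height (val i)) (fun=> false) (fun i => sval (J_grading i)).

Lemma J_leveled : leveled J_label.
Proof. by apply: attach_leveled spine_triangle_free _ => i; apply: svalP. Qed.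

Lemma J_term_nonadj : ~~ adj (term_a J) (term_b J).
Proof. by []. Qed.

(** Numbering by the natural numbers makes the next and the previous vertex of
the spine k.+1 and k.-1; indices are reduced modulo 7. *)
Definition spine_pt (k : nat) : J := inl (inZp k : 'I_7).

Lemma spine_pt_attached k : k < 7 -> attached (tower (height k)) (spine_pt k).
Proof.
move=> k7; have := @attached_private spine J_gadget (inZp k).
by rewrite J_gadgetE /= modn_small.
Qed.

(** The private neighbours of x_k all have level [height k], so a neighbour of
another level lies on the spine. *)
Lemma spine_nbr k x : k < 7 -> adj (spine_pt k) x -> (J_label x).1 != height k ->
  (k < 6 /\ x = spine_pt k.+1) \/ (0 < k /\ x = spine_pt k.-1).
Proof.
move=> k7 kx lx; have ik : val (inZp k : spine) = k by rewrite /= modn_small.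
have [||j -> kj] := @attach_nbr_root _ _ (fun i : spine => height (val i))
  (fun=> false) (fun i => sval (J_grading i)) _ _ _ kx.
- by move=> i; apply: svalP.
- by rewrite ik.
have jE : inZp (val j) = j :> 'I_7 by apply: valZpK.
case/orP: kj; rewrite ik => /eqP jk.
  left; split; first by have := ltn_ord j; rewrite -[nat_of_ord j]/(val j) jk.
  by rewrite /spine_pt -jk jE.
by right; rewrite jk /spine_pt /= jE.
Qed.

Section Walk.
Variable H : digraph.
Local Notation Y := (replacement H J).
Local Notation copy e x := (copy_vertex e x : Y).
Local Notation level y := ((repl_label J_label (y : Y)).1).

Lemma level_terminal (p : Y) : level p = 3 -> exists u, p = repl_inl J u.
Proof.
case: p => [u|[e [[i|q] nx]]]; first by exists u.
  by case: i nx => [[|[|[|[|[|[|[|//]]]]]]] ?].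
have [_ le _ _] := svalP (J_grading (tag q)); have := le (tagged q).
have : height (val (tag q)) <= 2 by case: (tag q) => [[|[|[|[|[|[|[|//]]]]]]] ?].
by move=> h2 lh /= l3; have := leq_trans lh h2; rewrite l3.
Qed.

Lemma copy_spine_nbr e k (y : Y) :
    0 < k < 6 -> adj (copy e (spine_pt k)) y -> level y != height k ->
  y = copy e (spine_pt k.+1) \/ y = copy e (spine_pt k.-1).
Proof.
move=> k6 kx lx; have k7 : k < 7 by lia.
have nk : ~~ terminal (spine_pt k).
  by rewrite /terminal; move: k6 {kx lx k7}; case: k => [|[|[|[|[|[|]]]]]].
have [x yE kx'] := repl_nbr nk kx; subst y.
rewrite repl_label_copy // in lx.
by case: (spine_nbr k7 kx' lx) => -[_ ->]; [left|right].
Qed.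

Lemma level_spine e k : k < 7 -> level (copy e (spine_pt k)) = (height k).+1.
Proof. by move=> k7; rewrite repl_label_copy //= modn_small. Qed.

Lemma copy_spine0 e : copy e (spine_pt 0) = repl_inl J (val e).1.
Proof. by rewrite /copy_vertex insubF. Qed.

Lemma copy_spine6 e : copy e (spine_pt 6) = repl_inl J (val e).2.
Proof. by rewrite /copy_vertex insubF. Qed.

(** The neighbours of a private vertex are in its gadget or are the root of it,
so their level exceeds the height of the gadget by at most one. *)
Lemma private_not_level3 e (q : {i : spine & J_gadget i}) (y : Y) :
  height (val (tag q)) < 2 -> adj (copy e (inr q : J)) y -> level y != 3.
Proof.
move=> hq; have nq : ~~ terminal (inr q : J) by [].
case/(repl_nbr nq)=> x -> qx; rewrite repl_label_copy //.
have := attach_nbr_private (fun=> false) (fun i => svalP (J_grading i)) qx.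
by move=> le; rewrite neq_ltn ltnS (leq_trans le).
Qed.

(** The levels differ at each step from the height of the gadget just carried,
which keeps the walk on the spine, except from x4 (carrying a B gadget) to level
1.  There the walk could enter the gadget of x4, but then could not reach level
3 in one step. *)
Lemma spine_walk_arc (p y1 y2 y3 y4 y5 q : Y) :
    path (@adj Y) p [:: y1; y2; y3; y4; y5; q] ->
    [seq level y | y <- [:: p; y1; y2; y3; y4; y5; q]] = [:: 3; 1; 1; 2; 2; 1; 3] ->
  exists u v : H, [/\ Defs.arc u v, p = repl_inl J u & q = repl_inl J v].
Proof.
move=> /and5P[a01 a12 a23 a34 /and3P[a45 a56 _]] [l0 l1 l2 l3 l4 l5 l6].
have [u pu] := level_terminal l0.
have [e [x0 [x1 [x01 px0 y1x1]]]] := repl_adjP a01.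
have y1E : x0 = spine_pt 0 /\ y1 = copy e (spine_pt 1).
  have lx1 : (J_label x1).1 = 1 by rewrite -l1 y1x1 repl_label_copy.
  have [x00|x06] : x0 = spine_pt 0 \/ x0 = spine_pt 6.
    move: px0; rewrite pu; case: copyP => // -> _; [left|right];
      by congr inl; apply: val_inj.
    subst x0; case: (spine_nbr (k := 0) isT x01) => [|[_ x1E]|[]] //.
      by rewrite lx1.
    by rewrite y1x1 x1E.
  subst x0; case: (spine_nbr (k := 6) isT x01) => [|[]|[_ x1E]] //.
    by rewrite lx1.
  (* The walk started at the far terminal: from x5 it would need a neighbour of
     level 1. *)
  rewrite y1x1 x1E in a12; case: (copy_spine_nbr (k := 5) isT a12) => [|y2E|y2E].
  - by rewrite l2.
  - by move: l2; rewrite y2E level_spine.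
  - by move: l2; rewrite y2E level_spine.
case: y1E => x0E y1E; exists (val e).1, (val e).2; split; first exact: (valP e).
  by rewrite px0 x0E copy_spine0.
have {a12} y2E : y2 = copy e (spine_pt 2).
  rewrite y1E in a12; case: (copy_spine_nbr (k := 1) isT a12) => //; rewrite ?l2 // => y2E.
  by move: l2; rewrite y2E level_spine.
have {a23} y3E : y3 = copy e (spine_pt 3).
  rewrite y2E in a23; case: (copy_spine_nbr (k := 2) isT a23) => //; rewrite ?l3 // => y3E.
  by move: l3; rewrite y3E level_spine.
have {a34} y4E : y4 = copy e (spine_pt 4).
  rewrite y3E in a34; case: (copy_spine_nbr (k := 3) isT a34) => //; rewrite ?l4 // => y4E.
  by move: l4; rewrite y4E level_spine.
rewrite y4E in a45; have n4 : ~~ terminal (spine_pt 4) by [].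
have [x5 y5x x45] := repl_nbr n4 a45; subst y5.
(* The private neighbours of x4 have level 1 as well; y5 is none of them because
   its successor q has level 3. *)
case: x5 x45 {a45} l5 a56 => [j x45 l5|w /andP[/eqP wE _] _ a56]; last first.
  have hw : height (val (tag w)) < 2 by rewrite -wE.
  by have := private_not_level3 hw a56; rewrite l6.
have -> : (inl j : J) = spine_pt 5.
  move: x45 l5; rewrite repl_label_copy //.
  by case: j => [[|[|[|[|[|[|[|//]]]]]]] ?] //= _ _; congr inl; apply: val_inj.
move=> a56; case: (copy_spine_nbr (k := 5) isT a56) => [||qE]; first by rewrite l6.
  by rewrite copy_spine6.
by move: l6; rewrite qE level_spine.
Qed.

End Walk.

Theorem proposition4p7 (R : realType) : quantum_endpoint_forcing R J.
Proof.
move=> H d F qF p q npq; apply/eqP/contraT=> nz; case: npq.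
have lev := @repl_leveled H J J_term_nonadj J_label erefl J_leveled.
have lvl k y : k < 7 -> F (spine_pt k) y != 0%R ->
    (repl_label J_label y).1 = (height k).+1.
  by move=> k7; apply: (qhom_level qF lev); apply: spine_pt_attached.
have aE : term_a J = spine_pt 0 by congr inl; apply: val_inj.
have bE : term_b J = spine_pt 6 by congr inl; apply: val_inj.
rewrite aE bE in nz.
have sp : path (@adj J) (spine_pt 0) [seq spine_pt k | k <- iota 1 6] by [].
have [t [wt lt]] := qhom_walk qF sp nz.
case: t wt lt => [|y1 [|y2 [|y3 [|y4 [|y5 [|y6 [|? ?]]]]]]] wt lt; rewrite /= ?andbF //.
case/and5P=> nz0 nz1 nz2 nz3 /and4P[nz4 nz5 nz6 _].
rewrite -lt; apply: spine_walk_arc wt _ => /=.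
by rewrite (lvl 0 _ isT nz0) (lvl 1 _ isT nz1) (lvl 2 _ isT nz2) (lvl 3 _ isT nz3)
  (lvl 4 _ isT nz4) (lvl 5 _ isT nz5) (lvl 6 _ isT nz6).
Qed.
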